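(* Consider, on one (curvilinear, hexahedral) element of a three-dimensional mesh with tensor-product nodes $ijk$, $i,j,k\in\{0,\dots,N\}$, a discretization scheme for a non-conservative system that is obtained by blending two schemes at the element level, $$J_{ijk}\omega_{ijk}\dot{\mathbf u}_{ijk}=(1-\alpha)\mathbf F^{\mathrm{DG}}_{ijk}+\alpha\,\mathbf F^{\mathrm{FV}}_{ijk},\qquad\forall\, i,j,k\in\{0,\dots,N\},$$ where $\alpha$ is an element-local blending coefficient (constant in the element), and both of the schemes are of the form $$\begin{aligned}\mathbf F^m_{ijk}=\ &\mathbf F^m_{K,ijk}+\omega_{jk}\left(\delta_{i0}\left[\hat{\mathbf f}^a_{(0,L)jk}+\boldsymbol\Phi^\Diamond_{(0,L)jk}\right]-\delta_{iN}\left[\hat{\mathbf f}^a_{(N,R)jk}+\boldsymbol\Phi^\Diamond_{(N,R)jk}\right]\right)\\&+\omega_{ik}\left(\delta_{j0}\left[\hat{\mathbf f}^a_{i(0,L)k}+\boldsymbol\Phi^\Diamond_{i(0,L)k}\right]-\delta_{jN}\left[\hat{\mathbf f}^a_{i(N,R)k}+\boldsymbol\Phi^\Diamond_{i(N,R)k}\right]\right)\\&+\omega_{ij}\left(\delta_{k0}\left[\hat{\mathbf f}^a_{ij(0,L)}+\boldsymbol\Phi^\Diamond_{ij(0,L)}\right]-\delta_{kN}\left[\hat{\mathbf f}^a_{ij(N,R)}+\boldsymbol\Phi^\Diamond_{ij(N,R)}\right]\right),\qquad m\in\{\mathrm{FV},\mathrm{DG}\},\end{aligned}$$ with $\mathbf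 F^m_{K,ijk}$ being any discretization terms that depend only on the inner states of the element. Then the semi-discrete entropy balance is $$\sum_{i,j,k=0}^NJ_{ijk}\omega_{ijk}\dot S_{ijk}=\dot S_{\partial K}+(1-\alpha)\dot S_K^{\mathrm{DG}}+\alpha\,\dot S_K^{\mathrm{FV}},$$ where $\dot S^m_K$ is the entropy production of scheme $m$ inside the element, which depends only on inner states, and $\dot S_{\partial K}$ gathers the entropy flux and production on the boundaries of the element, which are intrinsic to the choice of the surface numerical flux function and the surface non-conservative term: $$\begin{aligned}\dot S_{\partial K}=\ &\sum_{j,k=0}^N\omega_{jk}\left(\hat f^S_{(0,L)jk}-\hat f^S_{(N,R)jk}+\tfrac12\left(r_{(L,0)jk}+r_{(N,R)jk}\right)\right)\\&+\sum_{i,k=0}^N\omega_{ik}\left(\hat f^S_{i(0,L)k}-\hat f^S_{i(N,R)k}+\tfrac12\left(r_{i(L,0)k}+r_{i(N,R)k}\right)\right)\\&+\sum_{i,j=0}^N\omega_{ij}\left(\hat f^S_{ij(0,L)}-\hat f^S_{ij(N,R)}+\tfrac12\left(r_{ij(L,0)}+r_{ij(N,R)}\right)\right).\end{aligned}$$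
   Context: Setting. The system has state vector $\mathbf u$, a strictly convex entropy $S(\mathbf u)$, entropy variables $\mathbf v=\partial S/\partial\mathbf u$ and a spatial-vector-valued entropy flux potential $\vec\Psi(\mathbf u)\in\mathbb R^3$. (For the GLM-MHD system, $\vec\Psi=\mathbf v^T\mathbf f^a-\vec f^{\,S}+\theta\vec B$ componentwise in space, where $\mathbf f^a=(\mathbf f^a_1,\mathbf f^a_2,\mathbf f^a_3)$ is the advective flux, $\vec f^{\,S}$ the entropy flux, $\vec B$ the magnetic field, $\theta=\mathbf v^T\boldsymbol\phi^{\mathrm{MHD}}$ and $\boldsymbol\phi^{\mathrm{MHD}}$ the coefficient vector of the Powell term $(\nabla\cdot\vec B)\boldsymbol\phi^{\mathrm{MHD}}$.) Subscripts $ijk$ mean evaluation at $\mathbf u_{ijk}$; $\dot S_{ijk}=\mathbf v_{ijk}^T\dot{\mathbf u}_{ijk}$. $\omega_i$ are the one-dimensional Legendre-Gauss-Lobatto quadrature weights, $\omega_{ij}=\omega_i\omega_j$, $\omega_{ijk}=\omega_i\omega_j\omega_k$. $J_{ijk}$ is the mapping Jacobian and $J\vec a^1,J\vec a^2,J\vec a^3$ are the (Jacobian-scaled) contravariant metric vectors at the nodes; they are continuous across element boundaries. An index $L$ or $R$ replacing $i$ (respectively $j$, $k$) denotes the outer state across the boundary face with $i=0$ or $i=N$ (respectively $j$, $k$); the metric vector attached to it equals that of the adjacent boundary node. $[\![a]\!]_{(i,m)jk}=a_{mjk}-a_{ijk}$ and $\{\!\{a\}\!\}_{(i,m)jk}=\tfrac12(a_{ijk}+a_{mjk})$,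 and analogously for the second and third index, e.g. $i(j,m)k$ relates nodes $ijk$ and $imk$, and $ij(k,m)$ relates nodes $ijk$ and $ijm$. $\hat{\mathbf f}^a_{(i,m)jk}$ is a surface numerical flux (scaled by the metric terms), symmetric, $\hat{\mathbf f}^a_{(i,m)jk}=\hat{\mathbf f}^a_{(m,i)jk}$, and consistent, and $\boldsymbol\Phi^\Diamond_{(i,m)jk}$ is a surface numerical non-conservative term (scaled by the metric terms), in general not symmetric; analogously in the other directions. Both schemes use the same $\hat{\mathbf f}^a$ and $\boldsymbol\Phi^\Diamond$ on the element boundaries. Numerical entropy flux and entropy production (first direction; the other directions are analogous with $J\vec a^2$, $J\vec a^3$): $$\hat f^S_{(i,m)jk}=\{\!\{\mathbf v\}\!\}^T_{(i,m)jk}\hat{\mathbf f}^a_{(i,m)jk}+\tfrac12\mathbf v^T_{ijk}\boldsymbol\Phi^\Diamond_{(i,m)jk}+\tfrac12\mathbf v^T_{mjk}\boldsymbol\Phi^\Diamond_{(m,i)jk}-\{\!\{J\vec a^1\}\!\}_{(i,m)jk}\cdot\{\!\{\vec\Psi\}\!\}_{(i,m)jk},$$ $$r_{(i,m)jk}=[\![\mathbf v]\!]^T_{(i,m)jk}\hat{\mathbf f}^a_{(i,m)jk}+\mathbf v^T_{mjk}\boldsymbol\Phi^\Diamond_{(m,i)jk}-\mathbf v^T_{ijk}\boldsymbol\Phi^\Diamond_{(i,m)jk}-\{\!\{J\vec a^1\}\!\}_{(i,m)jk}\cdot[\![\vec\Psi]\!]_{(i,m)jk}.$$ Entropy production of scheme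 $m$ inside the element: $$\begin{aligned}\dot S^m_K=\sum_{i,j,k=0}^N\mathbf v_{ijk}^T\mathbf F^m_{K,ijk}&+\sum_{j,k=0}^N\omega_{jk}\left[(J\vec a^1)_{0jk}\cdot\vec\Psi_{0jk}-(J\vec a^1)_{Njk}\cdot\vec\Psi_{Njk}\right]\\&+\sum_{i,k=0}^N\omega_{ik}\left[(J\vec a^2)_{i0k}\cdot\vec\Psi_{i0k}-(J\vec a^2)_{iNk}\cdot\vec\Psi_{iNk}\right]\\&+\sum_{i,j=0}^N\omega_{ij}\left[(J\vec a^3)_{ij0}\cdot\vec\Psi_{ij0}-(J\vec a^3)_{ijN}\cdot\vec\Psi_{ijN}\right].\end{aligned}$$ *)

(* Defs.v *)
From HB Require Import structures.
From mathcomp Require Import all_boot all_order all_algebra.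
From mathcomp Require Import all_classical all_reals all_analysis.

Set Implicit Arguments.
Unset Strict Implicit.
Unset Printing Implicit Defensive.

Import Order.TTheory GRing.Theory Num.Theory.
Import numFieldNormedType.Exports.

Local Open Scope classical_set_scope.
Local Open Scope ring_scope.

(* Directions of the reference element.  They are kept apart from the
   coordinates of physical space, which are indexed by 'I_3. *)
Inductive direction := dir1 | dir2 | dir3.

Inductive scheme := FV | DG.

(* [OutL d a b] and [OutR d a b] carry the outer states across the faces where
   the index of direction [d] is 0, resp. N; [a] and [b] are the two remaining
   indices in increasing order of direction: [OutL dir1 j k] is Ljk,
   [OutL dir2 i k] is iLk and [OutL dir3 i j] is ijL. *)
Inductive node (N : nat) :=
| Inner of 'I_N.+1 & 'I_N.+1 & 'I_N.+1
| OutL of direction & 'I_N.+1 & 'I_N.+1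
| OutR of direction & 'I_N.+1 & 'I_N.+1.

Section LegendreGaussLobatto.
Variables (R : realType) (N : nat).
Implicit Types (xi w : 'I_N.+1 -> R).

(* Rodrigues' formula *)
Definition legendre (n : nat) : {poly R} :=
  (2 ^+ n * n`!%:R)^-1 *: (('X^2 - 1) ^+ n)^`(n).

Definition lagrange_basis xi (i : 'I_N.+1) : {poly R} :=
  \prod_(j < N.+1 | j != i) ((xi i - xi j)^-1 *: ('X - (xi j)%:P)).

(* The polynomial below has degree N + 1, so the N + 1 increasing points are
   all of its roots. *)
Definition LGL_nodes xi : Prop :=
  (forall i j : 'I_N.+1, (i < j)%N -> xi i < xi j) /\
  (forall i, root (('X^2 - 1) * (legendre N)^`()) (xi i)).

Definition LGL_weights xi w : Prop :=
  forall i, w i =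
    \int[lebesgue_measure]_(x in `[(-1 : R), 1]) (lagrange_basis xi i).[x].

End LegendreGaussLobatto.

Section Entropy.
Variables (R : realType) (n : nat).

Definition strictly_convex_on (D : set 'cV[R]_n) (S : 'cV[R]_n -> R) : Prop :=
  forall x y s, D x -> D y -> x <> y -> 0 < s -> s < 1 ->
    S (s *: x + (1 - s) *: y) < s * S x + (1 - s) * S y.

Definition entropy_vars (S : 'cV[R]_n -> R) (x : 'cV[R]_n) : 'cV[R]_n :=
  \col_i 'D_(delta_mx i 0 : 'cV[R]_n) S x.

End Entropy.

Definition dotv (R : realType) (m : nat) (x y : 'cV[R]_m) : R :=
  (x^T *m y) 0 0.

(* A two-point quantity [g] at the nodes [p] and [q] in direction [d] is
   [g d p q u_p u_q a_p a_q], with the states and the metric vectors of that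
   direction at the two nodes.  The nodes themselves are arguments so that [g]
   knows which of the two states lies on which side: a symmetric
   f_(i,m) = f_(m,i) may then still contain upwind dissipation, which is not
   symmetric in the bare states. *)
Definition two_point (R : realType) (n N : nat) :=
  direction -> node N -> node N ->
  'cV[R]_n -> 'cV[R]_n -> 'cV[R]_3 -> 'cV[R]_3 -> 'cV[R]_n.

Section Scheme.
Variables (R : realType) (n N : nat).

Definition symmetric_flux (D : set 'cV[R]_n) (g : two_point R n N) : Prop :=
  forall d p q x y a b, D x -> D y -> g d p q x y a b = g d q p y x b a.

Definition consistent_flux (D : set 'cV[R]_n) (fa : 'I_3 -> 'cV[R]_n -> 'cV[R]_n)
    (g : two_point R n N) : Prop :=
  forall d p q x a, D x -> g d p q x x a a = \sum_(e < 3) a e 0 *: fa e x.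

Definition metric_continuous (Ja : direction -> node N -> 'cV[R]_3) : Prop :=
  forall a b : 'I_N.+1,
  [/\ Ja dir1 (OutL dir1 a b) = Ja dir1 (Inner ord0 a b)
    /\ Ja dir1 (OutR dir1 a b) = Ja dir1 (Inner ord_max a b),
      Ja dir2 (OutL dir2 a b) = Ja dir2 (Inner a ord0 b)
    /\ Ja dir2 (OutR dir2 a b) = Ja dir2 (Inner a ord_max b)
    & Ja dir3 (OutL dir3 a b) = Ja dir3 (Inner a b ord0)
    /\ Ja dir3 (OutR dir3 a b) = Ja dir3 (Inner a b ord_max)].

Definition same_inner_states (U U' : node N -> 'cV[R]_n) : Prop :=
  forall i j k, U (Inner i j k) = U' (Inner i j k).

(* Terms F_K, given as functions of all states, inner and outer. *)
Definition volume_terms :=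
  (node N -> 'cV[R]_n) -> 'I_N.+1 -> 'I_N.+1 -> 'I_N.+1 -> 'cV[R]_n.

Definition inner_states_only (FK : volume_terms) : Prop :=
  forall U U', same_inner_states U U' ->
    forall i j k, FK U i j k = FK U' i j k.

Definition jump (V : zmodType) (a : node N -> V) (p q : node N) : V :=
  a q - a p.

Definition avg (V : lmodType R) (a : node N -> V) (p q : node N) : V :=
  2^-1 *: (a p + a q).

Variables (w : 'I_N.+1 -> R) (Ja : direction -> node N -> 'cV[R]_3).
Variables (S : 'cV[R]_n -> R) (Psi : 'cV[R]_n -> 'cV[R]_3).
Variables (fhat Phi : two_point R n N).
Variable U : node N -> 'cV[R]_n.

Definition at_nodes (g : two_point R n N) (d : direction) (p q : node N) :=
  g d p q (U p) (U q) (Ja d p) (Ja d q).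

Let f := at_nodes fhat.
Let phi := at_nodes Phi.
Let v (p : node N) := entropy_vars S (U p).
Let psi (p : node N) := Psi (U p).

Definition scheme_rhs (FK : volume_terms) (i j k : 'I_N.+1) : 'cV[R]_n :=
  FK U i j k
  + (w j * w k) *:
      ((i == ord0)%:R *:
         (f dir1 (Inner ord0 j k) (OutL dir1 j k)
          + phi dir1 (Inner ord0 j k) (OutL dir1 j k))
       - (i == ord_max)%:R *:
         (f dir1 (Inner ord_max j k) (OutR dir1 j k)
          + phi dir1 (Inner ord_max j k) (OutR dir1 j k)))
  + (w i * w k) *:
      ((j == ord0)%:R *:
         (f dir2 (Inner i ord0 k) (OutL dir2 i k)
          + phi dir2 (Inner i ord0 k) (OutL dir2 i k))
       - (j == ord_max)%:R *:
         (f dir2 (Inner i ord_max k) (OutR dir2 i k)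
          + phi dir2 (Inner i ord_max k) (OutR dir2 i k)))
  + (w i * w j) *:
      ((k == ord0)%:R *:
         (f dir3 (Inner i j ord0) (OutL dir3 i j)
          + phi dir3 (Inner i j ord0) (OutL dir3 i j))
       - (k == ord_max)%:R *:
         (f dir3 (Inner i j ord_max) (OutR dir3 i j)
          + phi dir3 (Inner i j ord_max) (OutR dir3 i j))).

Definition entropy_flux (d : direction) (p q : node N) : R :=
  dotv (avg v p q) (f d p q)
  + 2^-1 * dotv (v p) (phi d p q)
  + 2^-1 * dotv (v q) (phi d q p)
  - dotv (avg (Ja d) p q) (avg psi p q).

Definition entropy_prod (d : direction) (p q : node N) : R :=
  dotv (jump v p q) (f d p q)
  + dotv (v q) (phi d q p)
  - dotv (v p) (phi d p q)
  - dotv (avg (Ja d) p q) (jump psi p q).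

Let JaPsi (d : direction) (p : node N) : R := dotv (Ja d p) (psi p).

Definition entropy_prod_inside (FK : volume_terms) : R :=
  \sum_(i < N.+1) \sum_(j < N.+1) \sum_(k < N.+1)
     dotv (v (Inner i j k)) (FK U i j k)
  + \sum_(j < N.+1) \sum_(k < N.+1) w j * w k *
      (JaPsi dir1 (Inner ord0 j k) - JaPsi dir1 (Inner ord_max j k))
  + \sum_(i < N.+1) \sum_(k < N.+1) w i * w k *
      (JaPsi dir2 (Inner i ord0 k) - JaPsi dir2 (Inner i ord_max k))
  + \sum_(i < N.+1) \sum_(j < N.+1) w i * w j *
      (JaPsi dir3 (Inner i j ord0) - JaPsi dir3 (Inner i j ord_max)).

Definition entropy_prod_boundary : R :=
  \sum_(j < N.+1) \sum_(k < N.+1) w j * w k *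
     (entropy_flux dir1 (Inner ord0 j k) (OutL dir1 j k)
      - entropy_flux dir1 (Inner ord_max j k) (OutR dir1 j k)
      + 2^-1 * (entropy_prod dir1 (OutL dir1 j k) (Inner ord0 j k)
                + entropy_prod dir1 (Inner ord_max j k) (OutR dir1 j k)))
  + \sum_(i < N.+1) \sum_(k < N.+1) w i * w k *
     (entropy_flux dir2 (Inner i ord0 k) (OutL dir2 i k)
      - entropy_flux dir2 (Inner i ord_max k) (OutR dir2 i k)
      + 2^-1 * (entropy_prod dir2 (OutL dir2 i k) (Inner i ord0 k)
                + entropy_prod dir2 (Inner i ord_max k) (OutR dir2 i k)))
  + \sum_(i < N.+1) \sum_(j < N.+1) w i * w j *
     (entropy_flux dir3 (Inner i j ord0) (OutL dir3 i j)
      - entropy_flux dir3 (Inner i j ord_max) (OutR dir3 i j)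
      + 2^-1 * (entropy_prod dir3 (OutL dir3 i j) (Inner i j ord0)
                + entropy_prod dir3 (Inner i j ord_max) (OutR dir3 i j))).

End Scheme.

(* Main.v *)
(* At a boundary node p with outer neighbour q, the symmetry of the flux and the
   continuity of the metric vectors turn v_p . (f_(p,q) + Phi_(p,q)) into
   f^S_(p,q) + r_(q,p) / 2 + (Ja . Psi)_p = f^S_(p,q) - r_(p,q) / 2 + (Ja . Psi)_p.
   The potential terms are exactly the ones collected in the inner entropy
   production, so contracting the scheme with v and summing over the nodes gives
   the balance of each pure scheme; the balance of the blended scheme is their
   affine combination, because both share the same boundary terms. *)
Require Import Defs.
From mathcomp Require Import all_boot all_order all_algebra.
From mathcomp Require Import all_classical all_reals all_analysis.
From mathcomp Require Import ring.

Import Order.TTheory GRing.Theory Num.Theory.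
Import numFieldNormedType.Exports.

Local Open Scope classical_set_scope.
Local Open Scope ring_scope.

Section DotProduct.
Variables (R : realType) (m : nat).
Implicit Types (a : R) (x y z : 'cV[R]_m).

Lemma dotvDl x y z : dotv (x + y) z = dotv x z + dotv y z.
Proof. by rewrite /dotv linearD /= mulmxDl mxE. Qed.

Lemma dotvDr x y z : dotv x (y + z) = dotv x y + dotv x z.
Proof. by rewrite /dotv mulmxDr mxE. Qed.

Lemma dotvZl a x y : dotv (a *: x) y = a * dotv x y.
Proof. by rewrite /dotv linearZ /= -scalemxAl mxE. Qed.

Lemma dotvZr a x y : dotv x (a *: y) = a * dotv x y.
Proof. by rewrite /dotv -scalemxAr mxE. Qed.

Lemma dotvNl x y : dotv (- x) y = - dotv x y.
Proof. by rewrite -scaleN1r dotvZl mulN1r. Qed.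

Lemma dotvNr x y : dotv x (- y) = - dotv x y.
Proof. by rewrite -scaleN1r dotvZr mulN1r. Qed.

Definition dotvE := (dotvDl, dotvDr, dotvNl, dotvNr, dotvZl, dotvZr).

End DotProduct.

Lemma sum_delta (R : pzRingType) (I : finType) (i0 : I) (F : I -> R) :
  \sum_i (i == i0)%:R * F i = F i0.
Proof.
rewrite (bigD1 i0) //= eqxx mul1r big1 ?addr0 // => i /negPf ->.
by rewrite mul0r.
Qed.

(** Evaluates the contribution of two opposite faces at once: the Kronecker deltas of the scheme
    select the nodes with index 0 and N. *)
Lemma sum_delta_sub (R : comPzRingType) (I : finType) (i0 i1 : I)
    (c : R) (F G : I -> R) :
  \sum_i c * ((i == i0)%:R * F i - (i == i1)%:R * G i) = c * (F i0 - G i1).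
Proof. by rewrite -mulr_sumr sumrB !sum_delta. Qed.

Section EntropyBalance.
Variables (R : realType) (n N : nat).
Variables (w : 'I_N.+1 -> R) (Ja : direction -> node N -> 'cV[R]_3).
Variables (S : 'cV[R]_n -> R) (Psi : 'cV[R]_n -> 'cV[R]_3).
Variables (fhat Phi : two_point R n N) (D : set 'cV[R]_n).
Hypothesis fhat_sym : symmetric_flux D fhat.

Section Face.
Variables (U : node N -> 'cV[R]_n) (d : direction) (p q : node N).
Hypotheses (DUp : D (U p)) (DUq : D (U q)) (Jaqp : Ja d q = Ja d p).

Lemma at_nodes_sym : at_nodes Ja U fhat d q p = at_nodes Ja U fhat d p q.
Proof. exact: fhat_sym. Qed.

(** Jumps change sign, averages do not, the flux is symmetric, and the two non-conservative terms
    trade places. This is what allows the face at index 0 to be written with $r_{(L,0)}$ instead of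
    $r_{(0,L)}$. *)
Lemma entropy_prod_swap :
  entropy_prod Ja S Psi fhat Phi U d q p
  = - entropy_prod Ja S Psi fhat Phi U d p q.
Proof.
rewrite /entropy_prod /jump /avg at_nodes_sym Jaqp !dotvE.
by ring.
Qed.

(** Average minus half the jump is the value at [p], for [v] and for the potential alike. The halves
    of the non-conservative term at [p] add up, those at [q] cancel, and the averaged metric vector
    is the one at [p]. *)
Lemma face_entropy_balance :
  dotv (entropy_vars S (U p)) (at_nodes Ja U fhat d p q + at_nodes Ja U Phi d p q)
  = entropy_flux Ja S Psi fhat Phi U d p q
    - 2^-1 * entropy_prod Ja S Psi fhat Phi U d p q
    + dotv (Ja d p) (Psi (U p)).
Proof.
rewrite /entropy_flux /entropy_prod /jump /avg Jaqp !dotvE.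
by field.
Qed.

End Face.

Hypothesis Ja_cont : metric_continuous Ja.

Lemma scheme_entropy_balance (U : node N -> 'cV[R]_n) (FK : volume_terms R n N) :
  (forall p, D (U p)) ->
  \sum_(i < N.+1) \sum_(j < N.+1) \sum_(k < N.+1)
    dotv (entropy_vars S (U (Inner i j k)))
         (scheme_rhs w Ja fhat Phi U FK i j k)
  = entropy_prod_boundary w Ja S Psi fhat Phi U
    + entropy_prod_inside w Ja S Psi U FK.
Proof.
move=> DU.
pose v p := entropy_vars S (U p).
pose g d p q := at_nodes Ja U fhat d p q + at_nodes Ja U Phi d p q.
(* [p] will be the node at index 0 and [p'] the one at N. The outer minus sign makes the production
   at [p'] positive; at [p] the sign is absorbed by swapping the two nodes. *)
have faces d p q p' q' : Ja d q = Ja d p -> Ja d q' = Ja d p' ->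
    dotv (v p) (g d p q) - dotv (v p') (g d p' q')
    = (entropy_flux Ja S Psi fhat Phi U d p q
       - entropy_flux Ja S Psi fhat Phi U d p' q'
       + 2^-1 * (entropy_prod Ja S Psi fhat Phi U d q p
                 + entropy_prod Ja S Psi fhat Phi U d p' q'))
      + (dotv (Ja d p) (Psi (U p)) - dotv (Ja d p') (Psi (U p'))).
  move=> hp hp'; rewrite /v /g !face_entropy_balance //.
  by rewrite (entropy_prod_swap U d p q) //; ring.
pose G d p q p' q' := dotv (v p) (g d p q) - dotv (v p') (g d p' q').
have contract : \sum_(i < N.+1) \sum_(j < N.+1) \sum_(k < N.+1)
      dotv (v (Inner i j k)) (scheme_rhs w Ja fhat Phi U FK i j k)
    = \sum_(i < N.+1) \sum_(j < N.+1) \sum_(k < N.+1)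
        dotv (v (Inner i j k)) (FK U i j k)
      + \sum_(j < N.+1) \sum_(k < N.+1) w j * w k *
          G dir1 (Inner ord0 j k) (OutL dir1 j k)
                 (Inner ord_max j k) (OutR dir1 j k)
      + \sum_(i < N.+1) \sum_(k < N.+1) w i * w k *
          G dir2 (Inner i ord0 k) (OutL dir2 i k)
                 (Inner i ord_max k) (OutR dir2 i k)
      + \sum_(i < N.+1) \sum_(j < N.+1) w i * w j *
          G dir3 (Inner i j ord0) (OutL dir3 i j)
                 (Inner i j ord_max) (OutR dir3 i j).
  (* Each face sum is expanded by deltas into a sum over all nodes, so that the identity can be
     checked node by node. The delta sum must be innermost to collapse, which takes two exchanges in
     the first direction, one in the second and none in the third. *)
  have -> : \sum_(j < N.+1) \sum_(k < N.+1) w j * w k *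
          G dir1 (Inner ord0 j k) (OutL dir1 j k)
                 (Inner ord_max j k) (OutR dir1 j k)
    = \sum_(i < N.+1) \sum_(j < N.+1) \sum_(k < N.+1) w j * w k *
        ((i == ord0)%:R * dotv (v (Inner i j k))
            (g dir1 (Inner ord0 j k) (OutL dir1 j k))
         - (i == ord_max)%:R * dotv (v (Inner i j k))
            (g dir1 (Inner ord_max j k) (OutR dir1 j k))).
    rewrite [RHS]exchange_big; apply: eq_bigr => j _ /=.
    rewrite [RHS]exchange_big; apply: eq_bigr => k _ /=.
    by rewrite sum_delta_sub.
  have -> : \sum_(i < N.+1) \sum_(k < N.+1) w i * w k *
          G dir2 (Inner i ord0 k) (OutL dir2 i k)
                 (Inner i ord_max k) (OutR dir2 i k)
    = \sum_(i < N.+1) \sum_(j < N.+1) \sum_(k < N.+1) w i * w k *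
        ((j == ord0)%:R * dotv (v (Inner i j k))
            (g dir2 (Inner i ord0 k) (OutL dir2 i k))
         - (j == ord_max)%:R * dotv (v (Inner i j k))
            (g dir2 (Inner i ord_max k) (OutR dir2 i k))).
    apply: eq_bigr => i _; rewrite [RHS]exchange_big; apply: eq_bigr => k _ /=.
    by rewrite sum_delta_sub.
  have -> : \sum_(i < N.+1) \sum_(j < N.+1) w i * w j *
          G dir3 (Inner i j ord0) (OutL dir3 i j)
                 (Inner i j ord_max) (OutR dir3 i j)
    = \sum_(i < N.+1) \sum_(j < N.+1) \sum_(k < N.+1) w i * w j *
        ((k == ord0)%:R * dotv (v (Inner i j k))
            (g dir3 (Inner i j ord0) (OutL dir3 i j))
         - (k == ord_max)%:R * dotv (v (Inner i j k))
            (g dir3 (Inner i j ord_max) (OutR dir3 i j))).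
    apply: eq_bigr => i _; apply: eq_bigr => j _ /=.
    by rewrite sum_delta_sub.
  rewrite -!big_split; apply: eq_bigr => i _ /=.
  rewrite -!big_split; apply: eq_bigr => j _ /=.
  rewrite -!big_split; apply: eq_bigr => k _ /=.
  by rewrite /scheme_rhs /g !dotvE.
rewrite {}contract.
(* Separates, in each direction, the flux and production part from the potential part. Metric
   continuity then supplies the lower and upper face hypotheses of [faces]. *)
have split2 (F A B : 'I_N.+1 -> 'I_N.+1 -> R) :
    (forall a b, F a b = A a b + B a b) ->
    \sum_a \sum_b w a * w b * F a b
    = \sum_a \sum_b w a * w b * A a b + \sum_a \sum_b w a * w b * B a b.
  move=> FE; rewrite -big_split; apply: eq_bigr => a _ /=.
  by rewrite -big_split; apply: eq_bigr => b _ /=; rewrite FE mulrDr.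
rewrite /G.
rewrite (split2 _ _ _ (fun a b => faces _ _ _ _ _
  (proj1 (let: And3 h _ _ := Ja_cont a b in h))
  (proj2 (let: And3 h _ _ := Ja_cont a b in h)))).
rewrite (split2 _ _ _ (fun a b => faces _ _ _ _ _
  (proj1 (let: And3 _ h _ := Ja_cont a b in h))
  (proj2 (let: And3 _ h _ := Ja_cont a b in h)))).
rewrite (split2 _ _ _ (fun a b => faces _ _ _ _ _
  (proj1 (let: And3 _ _ h := Ja_cont a b in h))
  (proj2 (let: And3 _ _ h := Ja_cont a b in h)))).
rewrite /entropy_prod_boundary /entropy_prod_inside -!/(v _).
by ring.
Qed.

End EntropyBalance.

Theorem lemma6 (R : realType) (n N : nat) (hN : (0 < N)%N)
    (xi w : 'I_N.+1 -> R) (hxi : LGL_nodes xi) (hw : LGL_weights xi w)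
    (D : set 'cV[R]_n) (hDo : open D) (hDc : convex_set D)
    (S : 'cV[R]_n -> R) (hSc : strictly_convex_on D S)
    (hSd : forall x, D x -> differentiable S x)
    (Psi : 'cV[R]_n -> 'cV[R]_3)
    (J : 'I_N.+1 -> 'I_N.+1 -> 'I_N.+1 -> R)
    (Ja : direction -> node N -> 'cV[R]_3) (hJa : metric_continuous Ja)
    (fa : 'I_3 -> 'cV[R]_n -> 'cV[R]_n)
    (fhat Phi : two_point R n N)
    (hsym : symmetric_flux D fhat) (hcons : consistent_flux D fa fhat)
    (FK : scheme -> volume_terms R n N)
    (hFK : forall m, inner_states_only (FK m))
    (alpha t : R) (u : node N -> R -> 'cV[R]_n)
    (huD : forall p, D (u p t))
    (hud : forall i j k, derivable (u (Inner i j k)) t 1)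
    (hscheme : forall i j k,
       (J i j k * (w i * w j * w k)) *: derive1 (u (Inner i j k)) t
       = (1 - alpha) *: scheme_rhs w Ja fhat Phi (u ^~ t) (FK DG) i j k
         + alpha *: scheme_rhs w Ja fhat Phi (u ^~ t) (FK FV) i j k) :
  (\sum_(i < N.+1) \sum_(j < N.+1) \sum_(k < N.+1)
     J i j k * (w i * w j * w k) *
     dotv (entropy_vars S (u (Inner i j k) t)) (derive1 (u (Inner i j k)) t)
   = entropy_prod_boundary w Ja S Psi fhat Phi (u ^~ t)
     + (1 - alpha) * entropy_prod_inside w Ja S Psi (u ^~ t) (FK DG)
     + alpha * entropy_prod_inside w Ja S Psi (u ^~ t) (FK FV))
  /\ (forall m U U', same_inner_states U U' ->
        entropy_prod_inside w Ja S Psi U (FK m)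
        = entropy_prod_inside w Ja S Psi U' (FK m)).
Proof.
split; last first.
  (* All potentials and entropy variables here sit at inner nodes, so only the volume term calls for
     [hFK]. *)
  move=> m U U' eqU; rewrite /entropy_prod_inside.
  congr (_ + _ + _ + _); apply: eq_bigr => i _; apply: eq_bigr => j _ /=.
  - by apply: eq_bigr => k _; rewrite eqU (hFK m _ _ eqU).
  - by rewrite !eqU.
  - by rewrite !eqU.
  - by rewrite !eqU.
have balance m := scheme_entropy_balance _ _ _ w Ja S Psi fhat Phi D hsym hJa (u ^~ t)
  (FK m) huD.
pose v i j k := entropy_vars S (u (Inner i j k) t).
(* The scalar $J\omega$ moves onto the time derivative, where the blended scheme applies; [alpha]
   leaves the sums because it is constant in the element. *)
transitivity ((1 - alpha) *
      (\sum_(i < N.+1) \sum_(j < N.+1) \sum_(k < N.+1)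
        dotv (v i j k) (scheme_rhs w Ja fhat Phi (u ^~ t) (FK DG) i j k))
    + alpha *
      (\sum_(i < N.+1) \sum_(j < N.+1) \sum_(k < N.+1)
        dotv (v i j k) (scheme_rhs w Ja fhat Phi (u ^~ t) (FK FV) i j k))).
  rewrite !mulr_sumr -big_split; apply: eq_bigr => i _ /=.
  rewrite !mulr_sumr -big_split; apply: eq_bigr => j _ /=.
  rewrite !mulr_sumr -big_split; apply: eq_bigr => k _ /=.
  by rewrite -dotvZr hscheme !dotvE.
(* The common boundary term gets the total weight $(1-\alpha)+\alpha=1$. *)
rewrite !balance.
by ring.
Qed.
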